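(* Let $Y$ be a real topological vector space, $F\subseteq Y$, $a\in Y$, let $H$ be a proper closed subset of $Y$ and $k\in 0^+H\setminus\{0\}$. Then $M_{F,a,H,k}$ is nonempty and compact if $F$ is a nonempty compact set and $\varphi_{a-H,k}$ is finite-valued.
   Context: For $A\subseteq Y$, the recession cone is $0^+A:=\{u\in Y\mid A+\mathbb{R}_+u\subseteq A\}$, where $\mathbb{R}_+=[0,\infty)$. A proper subset of $Y$ is a nonempty subset different from $Y$. The functional $\varphi_{a-H,k}:Y\to\mathbb{R}\cup\{-\infty,+\infty\}$ is $\varphi_{a-H,k}(y):=\inf\{t\in\mathbb{R}\mid y\in a-H+tk\}$ with $\inf\emptyset=+\infty$. It is finite-valued if it attains only real values on $Y$. $(P_{F,a,H,k})$ is the problem of minimizing $t$ over all pairs $(y,t)\in F\times\mathbb{R}$ with $y\in a-H+tk$ (the feasible solutions). $M_{F,a,H,k}$ is the set of its optimal solutions $y$, i.e. of all $y\in F$ for which there is $t\in\mathbb{R}$ such that $(y,t)$ is feasible and $t\le s$ for every feasible $(z,s)$. *)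

(* Defs.v *)
From HB Require Import structures.
From mathcomp Require Import all_boot all_order all_algebra.
From mathcomp Require Import all_classical all_reals all_analysis.
Import Order.TTheory GRing.Theory Num.Theory.
Import numFieldNormedType.Exports.

Set Implicit Arguments.
Unset Strict Implicit.
Unset Printing Implicit Defensive.

Local Open Scope classical_set_scope.
Local Open Scope ring_scope.

Definition recession_cone (R : realType) (Y : lmodType R) (A : set Y) : set Y :=
  [set u | [set x + t *: u | x in A & t in [set t : R | 0 <= t]] `<=` A].

Definition proper_subset (T : Type) (A : set T) : Prop :=
  A !=set0 /\ A <> setT.

Definition point_sub (R : realType) (Y : lmodType R) (a : Y) (H : set Y) :
    set Y :=
  [set a - h | h in H].

Definition shift_along (R : realType) (Y : lmodType R) (A : set Y) (k : Y)
    (t : R) : set Y :=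
  [set x + t *: k | x in A].

(* [ereal_inf set0 = +oo], as required when no t qualifies. *)
Definition phi (R : realType) (Y : lmodType R) (A : set Y) (k y : Y) : \bar R :=
  ereal_inf [set t%:E | t in [set t : R | shift_along A k t y]].

Definition finite_valued (R : realType) (T : Type) (f : T -> \bar R) : Prop :=
  forall y, f y \is a fin_num.

Definition feasible (R : realType) (Y : lmodType R) (F : set Y) (a : Y)
    (H : set Y) (k : Y) : set (Y * R) :=
  [set p | F p.1 /\ shift_along (point_sub a H) k p.2 p.1].

Definition optimal_solutions (R : realType) (Y : lmodType R) (F : set Y)
    (a : Y) (H : set Y) (k : Y) : set Y :=
  [set y | F y /\ exists t : R, feasible F a H k (y, t) /\
     forall (z : Y) (s : R), feasible F a H k (z, s) -> t <= s].

(* Main.v *)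
(** Since [k] is in the recession cone of [H], the sets [a - H + t k] increase
    with [t], and they are closed. By compactness, some [y] in [F] lies in all
    those which meet [F]; hence every feasible [t] is feasible for [y]. As
    [phi y] is finite and the infimum defining it is attained (the set of
    admissible [t] is closed), the optimal value is [m = phi y], and the optimal
    solutions form the intersection of the compact set [F] with the closed set
    [a - H + m k]. *)

Require Import Defs.
From HB Require Import structures.
From mathcomp Require Import all_boot all_order all_algebra.
From mathcomp Require Import all_classical all_reals all_analysis.
Import Order.TTheory GRing.Theory Num.Theory.
Import numFieldNormedType.Exports.

Local Open Scope classical_set_scope.
Local Open Scope ring_scope.

(** The point on the right is affine in [t] and in [y], so monotonicity and closedness in either
    variable reduce to properties of [H]. *)
Lemma shift_point_subE {R : realType} {Y : lmodType R} {a : Y} {H : set Y}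
    {k : Y} {t : R} {y : Y} :
  shift_along (point_sub a H) k t y <-> H (a + t *: k - y).
Proof.
split=> [[_ [h Hh <-] <-]|Hy]; first by rewrite [a - h + _]addrAC subKr.
by exists (a - (a + t *: k - y)); [exists (a + t *: k - y)|rewrite addrAC subKr].
Qed.

Lemma shift_point_sub_homo {R : realType} {Y : lmodType R} {a : Y} {H : set Y}
    {k : Y} {s t : R} :
  recession_cone H k -> s <= t ->
  shift_along (point_sub a H) k s `<=` shift_along (point_sub a H) k t.
Proof.
move=> Hk st y /shift_point_subE Hs; apply/shift_point_subE/Hk.
(* Raising [s] to [t] moves the point of [H] by [(t - s) *: k], a nonnegative multiple of [k]. *)
exists (a + s *: k - y) => //; exists (t - s); first by rewrite /= subr_ge0.
by rewrite scalerBl addrAC -[a + _ + (_ - _)]addrA subrKC.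
Qed.

Lemma closed_shift_point_sub {R : realType} {Y : topologicalLmodType R}
    {a : Y} {H : set Y} {k : Y} {t : R} :
  closed H -> closed (shift_along (point_sub a H) k t).
Proof.
move=> cH.
rewrite (_ : shift_along _ _ _ = (fun y => a + t *: k - y) @^-1` H); last first.
  by apply/seteqP; split=> y /shift_point_subE.
apply: preimage_closed => // y _.
apply: (@continuous_comp _ _ _ (fun y => (a + t *: k, y))
  (fun x : Y * Y => x.1 - x.2)); last exact: sub_continuous.
by apply: cvg_pair => /=; [exact: cvg_cst|exact: cvg_id].
Qed.

Lemma closed_shift_parameters {R : realType} {Y : topologicalLmodType R}
    {a : Y} {H : set Y} {k y : Y} :
  closed H -> closed [set t : R^o | shift_along (point_sub a H) k t y].
Proof.
move=> cH.
rewrite (_ : [set _ | _] = (fun t : R^o => (a - y) + t *: k) @^-1` H); last first.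
  by apply/seteqP; split=> t /=; rewrite addrAC => /shift_point_subE.
apply: preimage_closed => // t _.
apply: (@continuous_comp _ _ _ (fun t : R^o => (a - y, t *: k))
  (fun x : Y * Y => x.1 + x.2)); last exact: add_continuous.
apply: cvg_pair => /=; first exact: cvg_cst.
apply: (@continuous_comp R^o (R^o * Y)%type Y (fun t => (t, k))
  (fun z => z.1 *: z.2)); last exact: scale_continuous.
by apply: (@cvg_pair _ _ _ _ (nbhs (t : R^o))) => /=;
  [exact: cvg_id|exact: cvg_cst].
Qed.

Lemma phi_attained {R : realType} {Y : topologicalLmodType R}
    {a : Y} {H : set Y} {k y : Y} :
  closed H -> phi (point_sub a H) k y \is a fin_num ->
  exists m : R, shift_along (point_sub a H) k m y /\
    forall t, shift_along (point_sub a H) k t y -> m <= t.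
Proof.
move=> cH fin; set m := fine (phi (point_sub a H) k y).
have mE : phi (point_sub a H) k y = m%:E by rewrite fineK.
have lbm t : shift_along (point_sub a H) k t y -> m <= t.
  by move=> yt; rewrite -lee_fin -mE; apply: ereal_inf_lbound; exists t.
exists m; split=> //.
have cT := @closed_shift_parameters R Y a H k y cH.
(* By closedness it suffices that every ball around [m] contains an admissible [t]; one below
   [m + e] exists, and [lbm] puts it above [m]. *)
apply: (cT m) => U.
rewrite -nbhs_ballE => -[e /= e0 meU].
have : (phi (point_sub a H) k y < (m + e)%:E)%E by rewrite mE lte_fin ltrDl.
move=> /ereal_inf_lt[_ [t /= yt <-]]; rewrite lte_fin => tme.
exists t; split=> //; apply: meU.
by rewrite /ball /= distrC ger0_norm ?subr_ge0 ?lbm// ltrBlDl.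
Qed.

(** The traces of the [G t] on [F] form a chain of nonempty sets, hence a base of a proper filter; a
    cluster point of it in [F] lies in the closure of each [G t]. *)
Lemma compact_nested_bigcap {R : realType} {T : topologicalType} {F : set T}
    {S : set R} {G : R -> set T} :
  compact F -> S !=set0 -> (forall t, closed (G t)) ->
  (forall s t, s <= t -> G s `<=` G t) ->
  (forall t, S t -> F `&` G t !=set0) ->
  F `&` \bigcap_(t in S) G t !=set0.
Proof.
move=> cF [t0 St0] cG G_homo FG0.
have PB : ProperFilter (filter_from S (fun t => F `&` G t)).
  apply: filter_from_proper => //; apply: filter_from_filter; first by exists t0.
  move=> s t Ss St; have [st|ts] := leP s t.
    by exists s => // y [Fy Gy]; split; split=> //; apply: G_homo Gy.
  by exists t => // y [Fy Gy]; split; split=> //; apply: G_homo Gy; exact: ltW.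
have [|y [Fy cly]] := cF _ PB; first by exists t0 => // y [].
exists y; split=> // t St; apply: cG.
by move: cly; rewrite clusterE; apply; exists t => // z [].
Qed.

Theorem proposition4 (R : realType) (Y : topologicalLmodType R)
    (F : set Y) (a : Y) (H : set Y) (k : Y)
    (H_proper : proper_subset H) (H_closed : closed H)
    (hk : (recession_cone H `\ 0) k)
    (F_nonempty : F !=set0) (F_compact : compact F)
    (phi_finite : finite_valued (phi (point_sub a H) k)) :
  optimal_solutions F a H k !=set0 /\ compact (optimal_solutions F a H k).
Proof.
have [Hk _] := hk.
have phi_min y := phi_attained H_closed (phi_finite y).
have [y [Fy Gy]] :
    F `&` \bigcap_(t in [set t | exists z, feasible F a H k (z, t)])
      shift_along (point_sub a H) k t !=set0.
  apply: compact_nested_bigcap => //.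
  (* Finiteness of [phi] at a single point of [F] provides a feasible [t]. *)
  - have [z Fz] := F_nonempty; have [t [zt _]] := phi_min z.
    by exists t, z.
  - by move=> t; exact: closed_shift_point_sub.
  - by move=> s t; exact: shift_point_sub_homo.
have [m [ym my]] := phi_min y.
have m_min z s : feasible F a H k (z, s) -> m <= s.
  by move=> zs; apply/my/Gy; exists z.
have -> : optimal_solutions F a H k = F `&` shift_along (point_sub a H) k m.
  apply/seteqP; split=> z [Fz].
    move=> [t [[/= _ zt] t_min]]; split=> //.
    (* Since [(y, m)] is feasible, optimality of [t] gives [t <= m]. *)
    by apply: shift_point_sub_homo zt => //; apply: (t_min y).
  by move=> zm; split=> //; exists m.
split; first by exists y.
by apply: compact_closedI => //; exact: closed_shift_point_sub.
Qed.
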